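(* Let $(\Omega,\mathcal{F},\mathbb{P})$ be a probability space, $(\Omega',\mathcal{F}')$ a measurable space, $t\ge 1$ an integer, and $Z$ a random variable on $(\Omega,\mathcal{F},\mathbb{P})$ with $0\le Z\le 1$. Let $U_i:(\Omega,\mathcal{F})\to(\Omega',\mathcal{F}')$, $0\le i<t$, be identically distributed random objects with $U_i\sim U$ for some fixed $U$. Set $W_i=\mathbb{E}(Z\mid U_i)$ and $W=(W_0+W_1+\cdots+W_{t-1})/t$ (random variables on $(\Omega',\mathcal{F}',\mathbb{P}_U)$), and take any $0<\varepsilon<1$. (i) If the random objects $U_i$ are independent, then $$\mathbb{E}(Z)\le \mathbb{P}_U\{W>\varepsilon\}^t+t\varepsilon .$$ (ii) If $0\le\beta\le 1$ and the random objects $U_i$ are $\beta$-independent, then $$\mathbb{E}(Z)\le(\alpha+\beta\,\mathbb{P}_U\{W>\varepsilon\})^t+t\varepsilon ,$$ where $\alpha=1-\beta$.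
   Context: A random object on $(\Omega,\mathcal{F},\mathbb{P})$ is a measurable function $U:(\Omega,\mathcal{F})\to(\Omega',\mathcal{F}')$; it induces the probability measure (its distribution) $\mathbb{P}_U(T)=\mathbb{P}\{U\in T\}$ on $(\Omega',\mathcal{F}')$. $U_i\sim U$ means that $U_i$ and $U$ have the same distribution. Conditional expectation (Kolmogorov's convention): for a random variable $Z$ on $\Omega$ and a random object $U:\Omega\to\Omega'$, $\mathbb{E}(Z\mid U)$ is a random variable $V$ on $(\Omega',\mathcal{F}',\mathbb{P}_U)$ (not on $\Omega$) such that $\int_S V\,d\mathbb{P}_U=\int_{\{U\in S\}}Z\,d\mathbb{P}$ for all $S\in\mathcal{F}'$; it is unique up to a $\mathbb{P}_U$-null set. $\beta$-independence: for $0\le\beta\le1$ and $\alpha=1-\beta$, random objects $U_i:(\Omega,\mathcal{F})\to(\Omega'_i,\mathcal{F}'_i)$, $i<t$, are $\beta$-independent if for all events $T_i\in\mathcal{F}'_i$, writing $\mu_i=\mathbb{P}_{U_i}(T_i)$, $$\mathbb{P}\Big\{\bigwedge_{0\le i<t}U_i\in T_i\Big\}\le\prod_{0\le i<t}(\alpha+\beta\mu_i).$$ *)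

(* Defs.v *)
From HB Require Import structures.
From mathcomp Require Import all_boot all_order all_algebra.
From mathcomp Require Import all_classical all_reals all_analysis.

Set Implicit Arguments.
Unset Strict Implicit.
Unset Printing Implicit Defensive.

Import Order.TTheory GRing.Theory Num.Theory.

Local Open Scope classical_set_scope.
Local Open Scope ring_scope.
Local Open Scope ereal_scope.

Definition same_distribution (d d' : measure_display) (R : realType)
    (T : measurableType d) (T' : measurableType d') (P : probability T R)
    (X Y : {RV P >-> T'}) : Prop :=
  forall S : set T', measurable S -> distribution P X S = distribution P Y S.

(* Kolmogorov's convention: V is a version of E(Z | X) living on the codomain
   of X, equipped with the distribution of X, not on the domain of X. It is
   determined only up to a null set, hence a predicate rather than a function.
   Integrability is required so that the integrals of the (signed) V are
   genuine Lebesgue integrals. *)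
Definition is_conditional_expectation (d d' : measure_display) (R : realType)
    (T : measurableType d) (T' : measurableType d') (P : probability T R)
    (Z : {RV P >-> R}) (X : {RV P >-> T'})
    (V : {RV (distribution P X) >-> R}) : Prop :=
  (distribution P X).-integrable setT (EFin \o V) /\
  forall S : set T', measurable S ->
    \int[distribution P X]_(y in S) (V y)%:E =
    \int[P]_(x in X @^-1` S) (Z x)%:E.

(* Subfamilies are covered by taking some of the A i to be the whole space. *)
Definition mutually_independent (d : measure_display) (R : realType)
    (T : measurableType d) (P : probability T R) (t : nat)
    (d' : 'I_t -> measure_display) (T' : forall i, measurableType (d' i))
    (X : forall i, {RV P >-> T' i}) : Prop :=
  forall A : (forall i, set (T' i)), (forall i, measurable (A i)) ->
    P (\bigcap_(i in [set: 'I_t]) (X i @^-1` A i)) =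
    \prod_(i < t) distribution P (X i) (A i).

Definition beta_independent (d : measure_display) (R : realType)
    (T : measurableType d) (P : probability T R) (beta : R) (t : nat)
    (d' : 'I_t -> measure_display) (T' : forall i, measurableType (d' i))
    (X : forall i, {RV P >-> T' i}) : Prop :=
  forall A : (forall i, set (T' i)), (forall i, measurable (A i)) ->
    P (\bigcap_(i in [set: 'I_t]) (X i @^-1` A i)) <=
    \prod_(i < t) ((1 - beta)%:E + beta%:E * distribution P (X i) (A i)).

(* Main.v *)
(* Let A = {W > eps}. On the event that every U_i lands in A, bound Z by 1: its
   contribution is at most the probability of that event, which (beta-)
   independence controls. Off this event some U_i lands in ~A, and since Z >= 0
   the contribution is at most the sum over i of the integrals of Z over
   {U_i in ~A}. By the defining property of W_i and U_i ~ U this sum is the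
   integral over ~A of sum_i W_i = t W <= t eps against the law of U. *)
Require Import Defs.
From HB Require Import structures.
From mathcomp Require Import all_boot all_order all_algebra.
From mathcomp Require Import all_classical all_reals all_analysis.
From mathcomp Require Import measurable_realfun.

Set Implicit Arguments.
Unset Strict Implicit.
Unset Printing Implicit Defensive.

Import Order.TTheory GRing.Theory Num.Theory.

Local Open Scope classical_set_scope.
Local Open Scope ring_scope.
Local Open Scope ereal_scope.

Lemma integral_le_bigcap_sum_setC (R : realType) (d : measure_display)
    (T : measurableType d) (mu : {measure set T -> \bar R})
    (t : nat) (Z : T -> R) (A : 'I_t -> set T) :
  measurable_fun setT Z -> (forall x, 0 <= Z x <= 1)%R ->
  (forall i, measurable (A i)) ->
  \int[mu]_x (Z x)%:E <=
    mu (\bigcap_(i in [set: 'I_t]) A i) +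
    \sum_(i < t) \int[mu]_(x in ~` A i) (Z x)%:E.
Proof.
move=> mZ Z01 mA.
have Z0 x : 0 <= (Z x)%:E by rewrite lee_fin; case/andP: (Z01 x).
have mEZ : measurable_fun setT (fun x => (Z x)%:E) by exact/measurable_EFinP.
have mI : measurable (\bigcap_(i in [set: 'I_t]) A i).
  by apply: fin_bigcap_measurable => //; exact: finite_finset.
have mZA i : measurable_fun setT ((EFin \o Z) \_ (~` A i)).
  apply/(measurable_restrictT _ (measurableC (mA i))).
  exact: measurable_funS mEZ.
have ZA0 i x : 0 <= ((EFin \o Z) \_ (~` A i)) x.
  by rewrite patchE; case: ifP => _ //; exact: Z0.
set I := \bigcap_(i in _) _ in mI *.
have -> : mu I = \int[mu]_x (\1_I x)%:E by rewrite integral_indic// setIT.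
(* Every term becomes an integral over the whole space, so the right side merges into a single
   integral. *)
under eq_bigr do rewrite integral_mkcond.
have mEI : measurable_fun setT (fun x => (\1_I x : R)%:E).
  exact/measurable_EFinP.
have EI0 x : 0 <= (\1_I x : R)%:E by rewrite lee_fin.
rewrite -ge0_integral_sum// -ge0_integralD//; last 2 first.
- by move=> x _; exact: sume_ge0.
- exact: emeasurable_sum.
apply: ge0_le_integral => //.
  by apply: emeasurable_funD => //; exact: emeasurable_sum.
move=> x _; have [xI|/existsNP[i /not_implyP[_ xAi]]] :=
    pselect (forall i, [set: 'I_t] i -> A i x).
- rewrite indicE mem_set//.
  apply: (@le_trans _ _ 1); first by rewrite lee_fin; case/andP: (Z01 x).
  by rewrite leeDl// sume_ge0.
(* The summand at [i] already equals [Z x]; all other terms are nonnegative. *)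
- rewrite (bigD1 i)//= patchE mem_set//= addeC -addeA leeDl// adde_ge0//.
  exact: sume_ge0.
Qed.

(** The versions [Wi i] live over formally different laws; moving them all to the law of [U] lets
    the sum pass under one integral over [S]. *)
Lemma sum_integral_preimage_le (R : realType) (d d' : measure_display)
    (T : measurableType d) (T' : measurableType d') (P : probability T R)
    (t : nat) (Z : {RV P >-> R}) (U : {RV P >-> T'})
    (Ui : 'I_t -> {RV P >-> T'})
    (hU : forall i : 'I_t, same_distribution (Ui i) U)
    (Wi : forall i : 'I_t, {RV (distribution P (Ui i)) >-> R})
    (hW : forall i : 'I_t, is_conditional_expectation Z (Wi i))
    (S : set T') (c : R) :
  measurable S -> (0 <= c)%R ->
  (forall y, S y -> (\sum_(i < t) Wi i y <= c)%R) ->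
  \sum_(i < t) \int[P]_(x in Ui i @^-1` S) (Z x)%:E <= c%:E.
Proof.
move=> mS c0 hS.
have intW i : (distribution P U).-integrable S (EFin \o Wi i).
  apply: (integrableS measurableT) => //.
  have [/integrableP[mW finW] _] := hW i; apply/integrableP; split => //.
  rewrite (eq_measure_integral (distribution P (Ui i)))//.
  by move=> A mA _; exact: esym (hU i A mA).
have -> : \sum_(i < t) \int[P]_(x in Ui i @^-1` S) (Z x)%:E =
    \int[distribution P U]_(y in S) (\sum_(i < t) Wi i y)%:E.
  under [RHS]eq_integral do rewrite -sumEFin.
  rewrite integral_sum//; apply: eq_bigr => i _.
  rewrite -(hW i).2//; apply: eq_measure_integral => A mA _.
  exact: (hU i A mA).
(* A version [Wi i] may be negative on a null set, so monotonicity is used for integrable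
   functions. *)
apply: (@le_trans _ _ (\int[distribution P U]_(y in S) cst c%:E y)).
  apply: le_integral => //.
  - apply: (eq_integrable mS (fun y => \sum_(i < t) (Wi i y)%:E)).
      by move=> y _; rewrite sumEFin.
    by apply: (integrable_sum mS) => i _; exact: intW.
  - exact: finite_measure_integrable_cst.
  - by move=> y /set_mem; rewrite lee_fin; exact: hS.
rewrite integral_cst// -[leRHS]mule1 lee_wpmul2l//.
exact: probability_le1.
Qed.

Theorem theorem2p1 (R : realType) (d d' : measure_display)
    (T : measurableType d) (T' : measurableType d') (P : probability T R)
    (t : nat) (ht : (1 <= t)%N)
    (Z : {RV P >-> R}) (hZ : forall x : T, (0 <= Z x <= 1)%R)
    (U : {RV P >-> T'}) (Ui : 'I_t -> {RV P >-> T'})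
    (hU : forall i : 'I_t, same_distribution (Ui i) U)
    (Wi : forall i : 'I_t, {RV (distribution P (Ui i)) >-> R})
    (hW : forall i : 'I_t, is_conditional_expectation Z (Wi i))
    (W : T' -> R)
    (defW : W = (fun y : T' => (\sum_(i < t) Wi i y) / t%:R)%R)
    (eps : R) (heps : (0 < eps < 1)%R) :
  (mutually_independent Ui ->
     'E_P[Z] <=
       (distribution P U [set y | (eps < W y)%R]) ^+ t + (t%:R * eps)%:E) /\
  (forall beta : R, (0 <= beta <= 1)%R -> beta_independent beta Ui ->
     'E_P[Z] <=
       ((1 - beta)%:E + beta%:E * distribution P U [set y | (eps < W y)%R]) ^+ t
       + (t%:R * eps)%:E).
Proof.
case/andP: heps => eps0 _.
set A := [set y | (eps < W y)%R].
have mW : measurable_fun setT W.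
  by rewrite defW; apply: measurable_funM => //; exact: measurable_sum.
have mA : measurable A.
  have -> : A = setT `&` W @^-1` `]eps, +oo[.
    by apply/seteqP; split=> y; rewrite /= in_itv/= andbT; [|case].
  exact: mW.
(* Common to both claims: independence only enters afterwards, to bound the probability of the
   intersection. *)
have key : 'E_P[Z] <=
    P (\bigcap_(i in [set: 'I_t]) (Ui i @^-1` A)) + (t%:R * eps)%:E.
  rewrite expectation_def.
  have mUA i : measurable (Ui i @^-1` A).
    by rewrite -[X in measurable X]setTI; exact: measurable_funPT.
  have mZ := measurable_funPT Z.
  apply: le_trans (integral_le_bigcap_sum_setC P mZ hZ mUA) _.
  rewrite leeD2l//.
  apply: (sum_integral_preimage_le hU hW (S := ~` A)).
  - exact: measurableC.
  - by rewrite mulr_ge0// ltW.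
  - move=> y /negP; rewrite -leNgt defW.
    by rewrite ler_pdivrMr ?ltr0n// mulrC.
have betaE (beta : R) : \prod_(i < t)
    ((1 - beta)%:E + beta%:E * distribution P (Ui i) A) =
    ((1 - beta)%:E + beta%:E * distribution P U A) ^+ t.
  under eq_bigr do rewrite (hU _ _ mA).
  by rewrite big_const_ord iter_mule mule1.
split => [indep|beta _ indep]; apply: le_trans key _; rewrite leeD2r//.
- rewrite (indep (fun=> A))//.
  under eq_bigr do rewrite (hU _ _ mA).
  by rewrite big_const_ord iter_mule mule1.
- by rewrite -betaE; exact: (indep (fun=> A)).
Qed.
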